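(* Let $G$ be a locally compact group and let $\mathcal{H}$ be a uniformly recurrent subgroup (URS) of $G$. Then there exists a minimal continuous action of $G$ on a compact space $X$ whose stabilizer URS is $\mathcal{H}$, i.e. $\mathcal{S}_G(X) = \mathcal{H}$. Moreover, the action can be chosen so that the stabilizer map $\operatorname{Stab} \colon X \to \operatorname{Sub}(G)$, $x \mapsto \{g \in G : gx = x\}$, is continuous.
   Context: Locally compact groups and compact spaces are assumed Hausdorff. $\operatorname{Sub}(G)$ is the set of closed subgroups of $G$ with the Chabauty topology, which has as subbasis of open sets the sets $\{H : H \cap C = \varnothing\}$ with $C \subseteq G$ compact, and $\{H : H \cap V \neq \varnothing\}$ with $V \subseteq G$ open; it is a compact Hausdorff space on which $G$ acts continuously by conjugation. A uniformly recurrent subgroup (URS) of $G$ is a nonempty closed, conjugation-invariant, minimal subset of $\operatorname{Sub}(G)$ (minimal: every orbit in it is dense in it). An action on a nonempty compact space is minimal if every orbit is dense. For a minimal continuous action of $G$ on a compact space $X$, it is known that the closure $\overline{\operatorname{Stab}(X)}$ in $\operatorname{Sub}(G)$ contains a unique URS; this URS is called the stabilizer URS of the action and is denoted $\mathcal{S}_G(X)$. *)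

(* Defs.v *)
From HB Require Import structures.
From mathcomp Require Import all_boot.
From mathcomp Require Import boolp classical_sets topology.

Set Implicit Arguments.
Unset Strict Implicit.
Unset Printing Implicit Defensive.

Local Open Scope group_scope.
Local Open Scope classical_set_scope.

HB.mixin Record isTopologicalGroup G & Group G & Topological G := {
  mulg_continuous : continuous (fun p : G * G => p.1 * p.2) ;
  invg_continuous : continuous (fun g : G => g^-1)
}.

(* Neither separation nor local compactness is built in: both are hypotheses
   of the theorem. *)
#[short(type="topologicalGroupType")]
HB.structure Definition TopologicalGroup :=
  {G of Group G & Topological G & isTopologicalGroup G}.

Record closed_subgroup (G : topologicalGroupType) := ClosedSubgroup {
  subgroup_set :> set G ;
  subgroup_closed : closed subgroup_set ;
  subgroup1 : subgroup_set 1 ;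
  subgroupM : forall g h, subgroup_set g -> subgroup_set h ->
    subgroup_set (g * h) ;
  subgroupV : forall g, subgroup_set g -> subgroup_set g^-1
}.

Section Chabauty.
Context {G : topologicalGroupType}.
Implicit Types H K : closed_subgroup G.

Lemma closed_subgroup_ext H K : H = K :> set G -> H = K.
Proof.
case: H K => [A A1 A2 A3 A4] [B B1 B2 B3 B4] /= AB; subst B.
by congr ClosedSubgroup; exact: Prop_irrelevance.
Qed.

Definition chabauty_subbase : set (set (closed_subgroup G)) :=
  [set [set H : closed_subgroup G | H `&` C = set0] | C in @compact G] `|`
  [set [set H : closed_subgroup G | H `&` V !=set0] | V in @open G].

HB.instance Definition _ := gen_eqMixin (closed_subgroup G).
HB.instance Definition _ := gen_choiceMixin (closed_subgroup G).
HB.instance Definition _ :=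
  isSubBaseTopological.Build (closed_subgroup G) chabauty_subbase id.

Definition conj_set (g : G) (A : set G) : set G :=
  [set g * h * g^-1 | h in A].

Lemma conj_setE g A : conj_set g A = [set x | A (g^-1 * x * g)].
Proof.
apply/seteqP; split=> [_ [h Ah <-]|x Ax] /=.
  by rewrite !mulgA mulVg mul1g -mulgA mulVg mulg1.
by exists (g^-1 * x * g) => //; rewrite !mulgA mulgV mul1g -mulgA mulgV mulg1.
Qed.

Lemma conj_set_closed g H : closed (conj_set g H).
Proof.
rewrite conj_setE; apply: (@preimage_closed _ _ (fun x => g^-1 * x * g)).
  move=> x _.
  have lx : g^-1 * y @[y --> x] --> g^-1 * x.
    apply: (@continuous2_cvg _ _ _ _ _ _ _ _ (fun a b : G => a * b) _ _).
    - exact: (@mulg_continuous G (g^-1, x)).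
    - exact: cvg_cst.
    - exact: cvg_id.
  apply: (@continuous2_cvg _ _ _ _ _ _ _ _ (fun a b : G => a * b) _ _ _ lx).
  - exact: (@mulg_continuous G (g^-1 * x, g)).
  - exact: cvg_cst.
exact: subgroup_closed.
Qed.

Lemma conj_set1 g H : conj_set g H 1.
Proof. by rewrite conj_setE /= mulg1 mulVg; exact: subgroup1. Qed.

Lemma conj_setM g H x y :
  conj_set g H x -> conj_set g H y -> conj_set g H (x * y).
Proof.
rewrite conj_setE /= => Hx Hy.
have -> : g^-1 * (x * y) * g = (g^-1 * x * g) * (g^-1 * y * g).
  by rewrite !mulgA -(mulgA _ g) mulgV mulg1.
exact: subgroupM.
Qed.

Lemma conj_setV g H x : conj_set g H x -> conj_set g H x^-1.
Proof.
rewrite conj_setE /= => Hx.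
have -> : g^-1 * x^-1 * g = (g^-1 * x * g)^-1.
  by rewrite !invgM invgK mulgA.
exact: subgroupV.
Qed.

Definition conj_subgroup (g : G) (H : closed_subgroup G) : closed_subgroup G :=
  ClosedSubgroup (conj_set_closed (g := g) (H := H)) (conj_set1 g H)
    (@conj_setM g H) (@conj_setV g H).

End Chabauty.

Definition action_orbit (G X : Type) (act : G -> X -> X) (x : X) : set X :=
  range (act^~ x).

(* Orbits of points of [F] stay in [F], so such an orbit is dense in the
   subspace [F] exactly when its closure in [closed_subgroup G] contains [F]. *)
Definition is_URS (G : topologicalGroupType) (F : set (closed_subgroup G)) :=
  [/\ F !=set0, closed F,
      (forall (g : G) (K : closed_subgroup G), F K -> F (conj_subgroup g K))
    & (forall K : closed_subgroup G,
         F K -> F `<=` closure (action_orbit (@conj_subgroup G) K))].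

Record continuous_action (G : topologicalGroupType) (X : topologicalType) :=
  ContinuousAction {
  act :> G -> X -> X ;
  act1 : forall x, act 1 x = x ;
  actM : forall g h x, act (g * h) x = act g (act h x) ;
  act_continuous : continuous (fun p : G * X => act p.1 p.2)
}.

Definition minimal_action (G : topologicalGroupType) (X : topologicalType)
    (a : continuous_action G X) :=
  [set: X] !=set0 /\ forall x : X, dense (action_orbit a x).

Section Stabilizer.
Context (G : topologicalGroupType) (X : topologicalType).
Variables (T2X : hausdorff_space X) (a : continuous_action G X).

Definition stab_set (x : X) : set G := [set g | a g x = x].

Lemma stab_set_closed x : closed (stab_set x).
Proof.
apply: (@preimage_closed _ _ (fun g => a g x) [set x]).
  move=> g _.
  apply: (@continuous2_cvg _ _ _ _ _ _ _ _ (fun h y => a h y) g x).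
  - exact: (@act_continuous _ _ a (g, x)).
  - exact: cvg_id.
  - exact: cvg_cst.
exact/accessible_closed_set1/hausdorff_accessible.
Qed.

Lemma stab_set1 x : stab_set x 1.
Proof. exact: act1. Qed.

Lemma stab_setM x g h : stab_set x g -> stab_set x h -> stab_set x (g * h).
Proof. by rewrite /stab_set /= => gx hx; rewrite actM hx gx. Qed.

Lemma stab_setV x g : stab_set x g -> stab_set x g^-1.
Proof. by rewrite /stab_set /= => gx; rewrite -{1}gx -actM mulVg act1. Qed.

Definition Stab (x : X) : closed_subgroup G :=
  ClosedSubgroup (stab_set_closed (x := x)) (stab_set1 x)
    (@stab_setM x) (@stab_setV x).

(* [F] is the unique URS contained in the closure of [Stab(X)]; [unique]
   asserts that [F] has the property and that nothing else does. *)
Definition is_stabilizer_URS (F : set (closed_subgroup G)) :=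
  unique (fun K => is_URS K /\ K `<=` closure (range Stab)) F.

End Stabilizer.

(* Main.v *)
(* Fix a compact neighbourhood [L] of [1], some [H] in the URS and [g] in [G].
   The space [G / H] can be covered by the [L^-1 D j], [j < n], where each [D j]
   is so sparse that two of its points never differ by an element of
   [L g^-1 L^-1] unless they are equal.  If right translation by [g^-1]
   preserves all the [D j], seen as subsets of [G], then the point [d] of [D j]
   close to [1] and its translate [d g^-1] differ by [d g^-1 d^-1], hence
   [d H = d g^-1 H] and [g] belongs to [H].  So [H] is exactly the stabilizer of
   the tuple formed by [H] and all the [D j], for all [g].
   The properties of the [D j] used here are closed and invariant, in a
   product of spaces of closed subsets of [G] that is compact for the Fell
   topology: they pass to a minimal subset of this product, on which the
   stabilizer is a coordinate and is therefore continuous. *)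

From HB Require Import structures.
Require Import Defs.
From mathcomp Require Import all_boot finmap mathcomp_extra boolp.
From mathcomp Require Import classical_sets functions cardinality filter topology.

Set Implicit Arguments.
Unset Strict Implicit.
Unset Printing Implicit Defensive.

Local Open Scope group_scope.
Local Open Scope classical_set_scope.

(** A neighbourhood contains a finite intersection of subbasic sets, and filters are stable under
    finite intersections. *)
Lemma subbase_cvg (T : topologicalType) (b : set (set T))
    (openb : open = [set \bigcup_(U in D) U | D in subset^~ (finI_from b id)])
    (F : set_system T) (x : T) : Filter F ->
  (forall U, b U -> U x -> F U) -> F --> x.
Proof.
move=> FF Fb W; rewrite nbhsE => -[O [+ Ox] OW]; rewrite openb => -[D Dfin DO].
move: Ox OW; rewrite -DO => -[S DS Sx] SW.
have [J Jb JS] := Dfin _ DS.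
suff: F S by apply: filterS => y Sy; apply: SW; exists S.
rewrite -JS; apply: filter_bigI => U JU; apply: Fb; first exact/set_mem/Jb.
by move: Sx; rewrite /= -JS; exact.
Qed.

(** * The Fell topology on the closed subsets of a space *)

Record fell (Y : topologicalType) := Fell {
  fell_set :> set Y ;
  fell_closed : closed fell_set
}.

Section Fell.
Context {Y : topologicalType}.
Implicit Types A B : fell Y.

Lemma fell_ext A B : A = B :> set Y -> A = B.
Proof.
case: A B => [A cA] [B cB] /= AB; subst B.
by congr Fell; exact: Prop_irrelevance.
Qed.

Definition fell_subbase : set (set (fell Y)) :=
  [set [set A : fell Y | A `&` C = set0] | C in @compact Y] `|`
  [set [set A : fell Y | A `&` V !=set0] | V in @open Y].

HB.instance Definition _ := gen_eqMixin (fell Y).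
HB.instance Definition _ := gen_choiceMixin (fell Y).
HB.instance Definition _ :=
  isSubBaseTopological.Build (fell Y) fell_subbase id.

Lemma fell_subbase_open S : fell_subbase S -> open S.
Proof.
move=> bS; exists [set S]; last by rewrite bigcup_set1.
move=> _ ->; exists [fset S]%fset.
  by move=> i; rewrite in_fset1 => /eqP ->; exact: mem_set.
by rewrite set_fset1 bigcap_set1.
Qed.

Lemma miss_open C : compact C -> open [set A : fell Y | A `&` C = set0].
Proof. by move=> cC; apply: fell_subbase_open; left; exists C. Qed.

Lemma hit_open V : open V -> open [set A : fell Y | A `&` V !=set0].
Proof. by move=> oV; apply: fell_subbase_open; right; exists V. Qed.

Lemma fell_cvg (F : set_system (fell Y)) A : Filter F ->
    (forall C, compact C -> A `&` C = set0 -> F [set B | B `&` C = set0]) ->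
    (forall V, open V -> A `&` V !=set0 -> F [set B | B `&` V !=set0]) ->
  F --> A.
Proof.
move=> FF missA hitA; apply: (@subbase_cvg _ fell_subbase) => //.
by move=> _ [[C cC <-]|[V oV <-]]; [exact: missA|exact: hitA].
Qed.

Lemma nbhs_miss A C : compact C -> A `&` C = set0 ->
  nbhs A [set B : fell Y | B `&` C = set0].
Proof. by move=> cC AC; apply: open_nbhs_nbhs; split=> //; exact: miss_open. Qed.

Lemma nbhs_hit A V x : fell_set A x -> nbhs x V ->
  nbhs A [set B : fell Y | B `&` V !=set0].
Proof.
move=> Ax xV; have hitV : nbhs A [set B : fell Y | B `&` V° !=set0].
  apply: open_nbhs_nbhs; split; last by exists x.
  exact/hit_open/open_interior.
by apply: filterS hitV => B [y [By /interior_subset Vy]]; exists y.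
Qed.

(** An ultrafilter converges to the set of the points all of whose neighbourhoods are hit by almost
    every closed set. A compact set without such points is covered by finitely many open sets that
    almost every closed set misses. *)
Lemma fell_compact : compact [set: fell Y].
Proof.
rewrite compact_ultra => F FU _.
pose A : set Y := [set x | forall V, open V -> V x -> F [set B | B `&` V !=set0]].
have cA : closed A.
  move=> x clAx V oV Vx.
  have [y [Ay Vy]] := clAx V (open_nbhs_nbhs (conj oV Vx)).
  exact: Ay.
exists (Fell cA); split=> //; apply: fell_cvg => /= [C cC AC|V oV [x [Ax Vx]]].
  have missC x : C x -> \forall x' \near x & B \near F, ~ fell_set B x'.
    move=> Cx; have : ~ A x by move=> Ax; have : (A `&` C) x by []; rewrite AC.
    move=> /existsNP[V /not_implyP[oV /not_implyP[Vx nF]]].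
    exists (V, ~` [set B : fell Y | B `&` V !=set0]) => /=.
      split; first exact: open_nbhs_nbhs.
      by have [] := in_ultra_setVsetC [set B : fell Y | B `&` V !=set0] FU.
    by move=> [y B] /= [Vy nBV] By; apply: nBV; exists y.
  have /compact_near_coveringP ncC := cC.
  apply: filterS (ncC _ F _ _ missC) => B BC.
  by rewrite -subset0 => y [By Cy]; exact: BC By.
exact: Ax.
Qed.

End Fell.

Section LocallyCompact.
Context {Y : topologicalType}.
Hypotheses (T2Y : hausdorff_space Y) (lcY : locally_compact [set: Y]).

Lemma compact_nbhs (x : Y) (W : set Y) : nbhs x W ->
  exists K, [/\ compact K, nbhs x K & K `<=` W].
Proof.
move=> xW; have [U xU [cU clU]] := @lcY x I.
have {}xU : nbhs x U.
  by apply: (@filterS _ (nbhs x) _ [set y | setT y -> U y]) xU => y; apply.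
have [V xV VW] := compact_regular T2Y cU xU xW.
exists (U `&` closure V); split.
- exact: compact_closedI cU (@closed_closure _ _).
- by apply: filterI => //; apply: filterS xV; exact: subset_closure.
- by move=> y [_ /VW].
Qed.

(** A point of [A] outside [B] has a compact neighbourhood disjoint from [B]; hitting it and missing
    it separate [A] from [B]. *)
Lemma fell_hausdorff : hausdorff_space (fell Y).
Proof.
suff sub (A B : fell Y) : cluster (nbhs A) B -> A `<=` B.
  move=> A B AB; apply/fell_ext/seteqP; split; apply: sub => //.
  by move=> U V BU AV; rewrite setIC; exact: AB.
move=> clAB x Ax; apply: contrapT => nBx.
have [K [cK xK KB]] : exists K, [/\ compact K, nbhs x K & K `<=` ~` B].
  apply: compact_nbhs; apply: open_nbhs_nbhs; split=> //.
  exact/closed_openC/fell_closed.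
have missB : nbhs B [set B' : fell Y | B' `&` K = set0].
  by apply: nbhs_miss => //; rewrite -subset0 => y [By /KB].
have [C [[y Cy] CK]] := clAB _ _ (nbhs_hit Ax xK) missB.
by move: Cy; rewrite CK.
Qed.

End LocallyCompact.

Lemma act_cvg (G : topologicalGroupType) (Y : topologicalType)
    (b : continuous_action G Y) T (F : set_system T) (u : T -> G) (v : T -> Y)
    g y : Filter F ->
  u @ F --> g -> v @ F --> y -> b (u t) (v t) @[t --> F] --> b g y.
Proof.
move=> FF; apply: (@continuous2_cvg _ _ _ _ _ _ _ _ (fun h y => b h y)).
exact: (@act_continuous _ _ b (g, y)).
Qed.

(** * The induced action on closed subsets *)

Section FellAction.
Context (G : topologicalGroupType) (Y : topologicalType).
Hypotheses (T2Y : hausdorff_space Y) (lcY : locally_compact [set: Y]).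
Variable b : continuous_action G Y.

Lemma fell_act_closed g (A : fell Y) : closed [set y | fell_set A (b g^-1 y)].
Proof.
apply: (@preimage_closed _ _ (b g^-1)) => [y _|]; last exact: fell_closed.
by apply: act_cvg; [exact: cvg_cst|exact: cvg_id].
Qed.

Definition fell_act g A : fell Y := Fell (@fell_act_closed g A).

Lemma fell_act1 A : fell_act 1 A = A.
Proof. by apply/fell_ext/seteqP; split=> y /=; rewrite invg1 act1. Qed.

Lemma fell_actM g h A : fell_act (g * h) A = fell_act g (fell_act h A).
Proof. by apply/fell_ext/seteqP; split=> y /=; rewrite invgM actM. Qed.

Lemma fell_act_continuous :
  continuous (fun p : G * fell Y => fell_act p.1 p.2).
Proof.
move=> [g A]; apply: fell_cvg => /= [C cC AC|V oV [y [/= Ay Vy]]].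
  (* Near [(x, g)] the point [b g^-1 x] stays in a compact [K] missed by [A] and by the closed sets
     near [A]; compactness of [C] makes this uniform. *)
  have missC x : C x -> \forall x' \near x & p \near (g, A),
      ~ fell_set p.2 (b p.1^-1 x').
    move=> Cx; have nAx : ~ fell_set A (b g^-1 x).
      by move=> Ax; have : ([set y | fell_set A (b g^-1 y)] `&` C) x by [];
        rewrite AC.
    have [K [cK xK KA]] : exists K, [/\ compact K, nbhs (b g^-1 x) K & K `<=` ~` A].
      apply: compact_nbhs => //; apply: open_nbhs_nbhs; split=> //.
      exact/closed_openC/fell_closed.
    have missK : nbhs A [set A' : fell Y | A' `&` K = set0].
      by apply: nbhs_miss => //; rewrite -subset0 => z [Az /KA].
    have nearK : \forall z \near (x, (g, A)), K (b z.2.1^-1 z.1).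
      suff : b z.2.1^-1 z.1 @[z --> (x, (g, A))] --> b g^-1 x by apply.
      apply: act_cvg.
        apply: continuous_cvg; first exact: invg_continuous.
        by apply: (@cvg_comp _ _ _ snd fst); [exact: cvg_snd|exact: cvg_fst].
      exact: cvg_fst.
    have nearM : \forall z \near (x, (g, A)), fell_set z.2.2 `&` K = set0.
      have cvgA : z.2.2 @[z --> (x, (g, A))] --> A.
        by apply: (@cvg_comp _ _ _ snd snd); exact: cvg_snd.
      exact: cvgA missK.
    apply: filterS2 nearK nearM => -[x' [h B]] /= Kx' BK Bx'.
    by have : (B `&` K) (b h^-1 x') by []; rewrite BK.
  have /compact_near_coveringP ncC := cC.
  pose P (p : G * fell Y) x := ~ fell_set p.2 (b p.1^-1 x).
  apply: filterS (ncC _ (nbhs (g, A)) P _ missC) => p pC.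
  by rewrite /= -subset0 => z [/= Az Cz]; exact: (pC z).
have gV : nbhs (g, b g^-1 y) [set p | V (b p.1 p.2)].
  apply: (@act_continuous _ _ b (g, b g^-1 y)); rewrite /= -actM mulgV act1.
  exact: open_nbhs_nbhs.
have [[U W] /= [gU yW] UWV] := gV.
exists (U, [set B : fell Y | B `&` W !=set0]) => /=.
  by split=> //; exact: nbhs_hit yW.
move=> [h B] /= [Uh [z [Bz Wz]]]; exists (b h z).
by split; [rewrite /= -actM mulVg act1|exact: (UWV (h, z))].
Qed.

Definition fell_action : continuous_action G (fell Y) :=
  ContinuousAction fell_act1 fell_actM fell_act_continuous.

End FellAction.

(** * Products of actions and minimal subsystems *)

Lemma prod_cvg (I : Type) (T : I -> topologicalType) (U : Type)
    (F : set_system U) (f : U -> prod_topology T) (l : prod_topology T) :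
  Filter F -> (forall i, f u i @[u --> F] --> l i) -> f @ F --> l.
Proof.
move=> FF fl; apply/cvg_sup => i W [V [[O oO <-] Oli] OW].
apply: filterS OW _; apply: (fl i); exact: open_nbhs_nbhs.
Qed.

Section ProductAction.
Context (G : topologicalGroupType) (I : eqType) (T : I -> topologicalType).
Variable b : forall i, continuous_action G (T i).

Definition prod_act (g : G) (f : prod_topology T) : prod_topology T :=
  fun i => b i g (f i).

Lemma prod_act1 f : prod_act 1 f = f.
Proof. by apply: functional_extensionality_dep => i; exact: act1. Qed.

Lemma prod_actM g h f : prod_act (g * h) f = prod_act g (prod_act h f).
Proof. by apply: functional_extensionality_dep => i; exact: actM. Qed.

Lemma prod_act_continuous :
  continuous (fun p : G * prod_topology T => prod_act p.1 p.2).
Proof.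
move=> [g f]; apply: prod_cvg => i; apply: act_cvg; first exact: cvg_fst.
apply: (@cvg_comp _ _ _ snd (@proj I T i)); first exact: cvg_snd.
exact: proj_continuous.
Qed.

Definition prod_action : continuous_action G (prod_topology T) :=
  ContinuousAction prod_act1 prod_actM prod_act_continuous.

End ProductAction.

Section Subaction.
Context (G : topologicalGroupType) (E : topologicalType).
Variables (b : continuous_action G E) (M : set E).
Hypothesis Mb : forall g x, M x -> M (b g x).

Definition sub_act g (x : M) : M := SigSub (mem_set (Mb g (set_valP x))).

Lemma sub_act1 x : sub_act 1 x = x.
Proof. by apply: val_inj => /=; exact: act1. Qed.

Lemma sub_actM g h x : sub_act (g * h) x = sub_act g (sub_act h x).
Proof. by apply: val_inj => /=; exact: actM. Qed.

Lemma sub_act_continuous : continuous (fun p : G * M => sub_act p.1 p.2).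
Proof.
move=> [g x] W [V [[O oO <-] Ox] OW].
apply: filterS OW _.
have : b p.1 (set_val p.2) @[p --> (g, x)] --> b g (set_val x).
  apply: act_cvg; first exact: cvg_fst.
  apply: (@cvg_comp _ _ _ snd set_val); first exact: cvg_snd.
  exact: initial_continuous.
by apply; exact: open_nbhs_nbhs.
Qed.

Definition sub_action : continuous_action G M :=
  ContinuousAction sub_act1 sub_actM sub_act_continuous.

End Subaction.

Lemma set_type_hausdorff (E : topologicalType) (M : set E) :
  hausdorff_space E -> hausdorff_space M.
Proof.
move=> T2E x y xy; apply: val_inj; apply: T2E => A B xA yB.
have cM := @initial_continuous M E set_val.
by have [z [Az Bz]] := xy _ _ (cM x _ xA) (cM y _ yB); exists (set_val z).
Qed.

Lemma set_type_compact (E : topologicalType) (M : set E) :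
  compact M -> compact [set: M].
Proof.
move=> cM F FF _; have [|x [Mx clx]] := cM (set_val @ F) _.
  by apply: (@filterE _ F) => x; exact: set_valP.
exists (SigSub (mem_set Mx)); split=> // A B FA [V [[O oO <-] Ox] OB].
have FA' : (set_val @ F) (set_val @` A)
  by apply: (@filterS _ F _ _ _ _ FA) => z Az; exists z.
have [_ [[z Az <-] Oz]] := clx _ O FA' (open_nbhs_nbhs (conj oO Ox)).
by exists z; split=> //; exact: OB.
Qed.

(** * Minimal sets *)

Section Minimal.
Context (G : topologicalGroupType) (E : topologicalType).
Variables (b : continuous_action G E).

Definition act_invariant (A : set E) := forall g x, A x -> A (b g x).

Lemma act_invariantC A : act_invariant A -> act_invariant (~` A).
Proof.
by move=> Ab g x nAx Agx; apply: nAx; rewrite -(act1 b x) -(mulVg g) actM; exact: Ab.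
Qed.

Lemma act_continuous_r g : continuous (b g).
Proof. by move=> x; apply: act_cvg; [exact: cvg_cst|exact: cvg_id]. Qed.

Lemma invariant_closure_orbit x : act_invariant (closure (action_orbit b x)).
Proof.
move=> g y cly V Vgy.
have [_ [[h _ <-] Vh]] := cly _ (act_continuous_r Vgy).
by exists (b (g * h) x); split; [exists (g * h)|rewrite actM].
Qed.

(* Zorn's lemma for the open invariant sets that do not contain [Z], a property
   that compactness preserves along chains, including the empty one. *)
Lemma exists_minimal_set (Z : set E) :
    compact [set: E] -> closed Z -> act_invariant Z -> Z !=set0 ->
  exists M, [/\ M `<=` Z, closed M, act_invariant M, M !=set0
    & forall x, M x -> M `<=` closure (action_orbit b x)].
Proof.
move=> cE cZ Zb Z0.
pose P O := [/\ open O, act_invariant O & ~ Z `<=` O].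
have [C CP Ctot|O [[oO Ob ZO] maxO]] := @Zorn_bigcup E P.
  split; first by apply: bigcup_open => O /CP[].
    by move=> g x [O CO Ox]; exists O => //; have [_ Ob _] := CP _ CO; exact: Ob.
  move=> ZC; have [z0 /ZC[O0 CO0 _]] := Z0.
  (* The final segments of the chain form a filter; a near covering of [Z] along it makes a single
     member contain [Z]. *)
  pose F := filter_from C (fun O => [set O' | C O' /\ O `<=` O']).
  have FF : Filter F.
    apply: filter_from_filter; first by exists O0.
    move=> O1 O2 CO1 CO2; have [O12|O21] := Ctot _ _ CO1 CO2.
      by exists O2 => // O [CO O2O]; do !split=> //; exact: subset_trans O2O.
    by exists O1 => // O [CO O1O]; do !split=> //; exact: subset_trans O1O.
  have /compact_near_coveringP ncZ : compact Z by apply: (subclosed_compact cZ cE).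
  have [x /ZC[O CO Ox]|O1 CO1 FO1] := ncZ _ F (fun O x => O x).
  - exists (O, [set O' | C O' /\ O `<=` O']) => /=.
      split; last by exists O.
      by apply: open_nbhs_nbhs; split=> //; have [] := CP _ CO.
    by move=> [y O'] /= [Oy [_ OO']]; exact: OO'.
  - by have [_ _] := CP _ CO1; apply; apply: FO1; split.
exists (Z `\` O); split.
- by move=> x [].
- by apply: closedI => //; exact: open_closedC.
- by move=> g x [Zx nOx]; split; [exact: Zb|exact: act_invariantC].
- by apply: contrapT => /nonemptyPn; rewrite setD_eq0.
move=> x [Zx nOx] y [Zy nOy]; apply: contrapT => nxy.
(* The complement of the orbit closure of [x] is open and invariant; adding it to [O] gains [y] but
   still omits [x]. *)
apply: (maxO (O `|` ~` closure (action_orbit b x))).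
  by split=> [z Oz|sub]; [left|apply: nOy; apply: sub; right].
split.
- by apply: openU => //; exact/closed_openC/closed_closure.
- move=> g z [Oz|nz]; [by left; exact: Ob|right].
  by apply: act_invariantC nz; exact: invariant_closure_orbit.
- move=> /(_ x Zx)[//|]; apply; apply: subset_closure.
  by exists 1 => //; exact: act1.
Qed.

End Minimal.

(** * Covers by separated families of cosets *)

Lemma mulg_cvg (G : topologicalGroupType) T (F : set_system T)
    (u v : T -> G) x y : Filter F ->
  u @ F --> x -> v @ F --> y -> u t * v t @[t --> F] --> x * y.
Proof.
move=> FF; apply: (@continuous2_cvg _ _ _ _ _ _ _ _ (fun a b : G => a * b)).
exact: (@mulg_continuous G (x, y)).
Qed.

Lemma invg_cvg (G : topologicalGroupType) T (F : set_system T)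
    (u : T -> G) x : Filter F -> u @ F --> x -> (u t)^-1 @[t --> F] --> x^-1.
Proof. by move=> FF; apply: continuous_cvg; exact: invg_continuous. Qed.

(** A finite subcover, obtained from near coverings along the finite sequences ordered by
    inclusion. *)
Lemma compact_translates (G : topologicalGroupType) (C U : set G) :
    compact C -> nbhs 1 U ->
  exists s : seq G, forall x, C x -> exists2 k, k \in s & U (x * k^-1).
Proof.
move=> cC U1; pose F := filter_from setT
  (fun s0 : seq G => [set s : seq G | {subset s0 <= s}]).
have FF : Filter F.
  apply: filter_from_filter; first by exists [::].
  move=> s t _ _; exists (s ++ t) => // r str.
  by split=> k ks; apply: str; rewrite mem_cat ks ?orbT.
have /compact_near_coveringP ncC := cC.
pose P s x := exists2 k : G, k \in (s : seq G) & U (x * k^-1).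
have [x Cx|s _ sC] := ncC _ F P FF; last by exists s; exact: sC.
have Ux : nbhs x [set x' | U (x' * x^-1)].
  have xx : x' * x^-1 @[x' --> x] --> x * x^-1.
    by apply: mulg_cvg; [exact: cvg_id|exact: cvg_cst].
  by apply: xx; rewrite mulgV.
exists ([set x' | U (x' * x^-1)], [set s : seq G | {subset [:: x] <= s}]) => /=.
  by split=> //; exists [:: x].
by move=> [x' s] /= [Ux' xs]; exists x => //; apply: xs; rewrite mem_head.
Qed.

(** Choose [U] with [U U^-1] in [L] and cover [C] by right translates of [U]: among more points than
    translates, two share a translate. *)
Lemma compact_pigeonhole (G : topologicalGroupType) (C L : set G) :
    compact C -> nbhs 1 L ->
  exists n, forall d : 'I_n -> G, (forall j, C (d j)) ->
    exists i j : 'I_n, (i < j)%N /\ L (d i * (d j)^-1).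
Proof.
move=> cC L1.
have [U U1 UL] : exists2 U, nbhs (1 : G) U & forall x y, U x -> U y -> L (x * y^-1).
  have xy : p.1 * p.2^-1 @[p --> ((1, 1) : G * G)] --> (1 : G) * 1^-1.
    by apply: mulg_cvg; [exact: cvg_fst|apply: invg_cvg; exact: cvg_snd].
  have [|[U V] /= [U1 V1] UVL] := xy L; first by rewrite mulgV.
  exists (U `&` V); first exact: filterI.
  by move=> x y [Ux _] [_ Vy]; apply: (UVL (x, y)).
have [s sC] := compact_translates cC U1.
exists (size s).+1 => d Cd.
have /choice[f df] j : exists k : 'I_(size s), U (d j * (nth 1 s k)^-1).
  have [k ks Uk] := sC _ (Cd j).
  have ks' : (index k s < size s)%N by rewrite index_mem.
  by exists (Ordinal ks'); rewrite /= nth_index.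
have /injectivePn[i [j ij fij]] : ~~ injectiveb f.
  by apply/injectiveP => /leq_card; rewrite !card_ord ltnn.
wlog ltij : i j ij fij / (i < j)%N.
  move=> wlg; have [/wlg|/wlg|/val_inj eij] := ltngtP i j; [exact|apply|] => //.
  - by rewrite eq_sym.
  - by rewrite eij eqxx in ij.
exists i, j; split=> //.
rewrite (_ : _ * _ = (d i * (nth 1 s (f i))^-1) * (d j * (nth 1 s (f i))^-1)^-1).
  by apply: UL; rewrite // fij.
by rewrite invgM invgK mulgA mulgVK.
Qed.

Section Separated.
Context (G : topologicalGroupType).
Variables (H : closed_subgroup G) (K : set G).

(** Unions of left cosets of [H], that is, subsets of [G / H]. *)
Definition right_invariant (S : set G) :=
  forall d h, S d -> subgroup_set H h -> S (d * h).

Lemma right_invariantC (S : set G) : right_invariant S -> right_invariant (~` S).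
Proof.
move=> SH x h nSx Hh Sxh; apply: nSx.
by rewrite -(mulgK h x); apply: SH => //; exact: subgroupV.
Qed.

(** Read in [G / H]: distinct cosets in [S] never differ by left multiplication by an element of
    [K]. *)
Definition coset_separated (S : set G) := forall d d', S d -> S d' ->
  K (d' * d^-1) -> subgroup_set H (d^-1 * d').

(** Zorn's lemma: if no point of a maximal [S] were related to [x], the whole coset of [x] could be
    added to it. *)
Lemma exists_maximal_separated (A : set G) : right_invariant A ->
  exists S, [/\ S `<=` A, right_invariant S, coset_separated S
    & forall x, A x -> exists2 d, S d &
        [\/ K (d * x^-1), K (x * d^-1) | d = x]].
Proof.
move=> AH; pose P S := [/\ S `<=` A, right_invariant S & coset_separated S].
have [C CP Ctot|S [[SA SH Ssep] maxS]] := @Zorn_bigcup G P.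
  split.
  - by move=> x [S /CP[SA _ _]]; exact: SA.
  - by move=> d h [S CS Sd] Hh; exists S => //; have [_ SH _] := CP _ CS; exact: SH.
  - move=> d d' [S CS Sd] [S' CS' Sd'].
    have [SS'|S'S] := Ctot _ _ CS CS'.
      by have [_ _] := CP _ CS'; apply => //; exact: SS'.
    by have [_ _] := CP _ CS; apply => //; exact: S'S.
exists S; split=> // x Ax; apply: contrapT => nS.
(* Right invariance of [S] moves [h] from [x] to [d], so no point of the coset of [x] is related to
   [S]. *)
have far d h : S d -> subgroup_set H h ->
    ~ K (d * (x * h)^-1) /\ ~ K (x * h * d^-1).
  move=> Sd Hh; have Sdh := SH _ _ Sd (subgroupV Hh).
  split=> Kd; apply: nS; exists (d * h^-1) => //.
    by constructor 1; rewrite -mulgA -invgM.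
  by constructor 2; rewrite invgM invgK mulgA.
apply: (maxS (S `|` [set x * h | h in subgroup_set H])); split.
- by move=> z Sz; left.
- move=> sub; apply: nS; exists x; last by constructor 3.
  by apply: sub; right; exists 1; [exact: subgroup1|rewrite mulg1].
- by move=> z [/SA//|[h Hh <-]]; exact: AH.
- move=> d h [Sd Hh|[h' Hh' <-] Hh]; first by left; exact: SH.
  by right; exists (h' * h); [exact: subgroupM|rewrite mulgA].
- move=> d d' [Sd|[h Hh <-]] [Sd'|[h' Hh' <-]].
  + exact: Ssep.
  + by have [_ nK /nK] := far _ _ Sd Hh'.
  + by have [nK _ /nK] := far _ _ Sd' Hh.
  (* Two points of the same coset satisfy the conclusion whatever [K] is. *)
  + move=> _; rewrite invgM -mulgA mulKg.
    by apply: subgroupM => //; exact: subgroupV.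
Qed.

(** Union of the [L^-1 D j] for [j < n]; each [D j] is the value of [M] at what the earlier classes
    leave uncovered. *)
Fixpoint covered (L : set G) (M : set G -> set G) n : set G :=
  if n is n'.+1 then covered L M n' `|`
    [set x | exists2 d, M (~` covered L M n') d & L (d * x^-1)]
  else set0.

(* Greedy colouring: [D j] is a maximal [K]-separated subset of what the
   previous [L^-1 D i] leave uncovered.  A point that is never covered is
   [K]-close to a point of each [D j], and these points are pairwise [L]-apart;
   compactness bounds their number. *)
Lemma exists_separated_cover (C L : set G) :
    K `<=` C -> compact C -> nbhs 1 L ->
  exists (n : nat) (D : nat -> set G), [/\ forall j, right_invariant (D j),
    forall j, coset_separated (D j)
    & forall x, exists j d, [/\ (j < n)%N, D j d & L (d * x^-1)]].
Proof.
move=> KC cC L1.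
have /choice[M MP] A : exists S, right_invariant A ->
  [/\ S `<=` A, right_invariant S, coset_separated S
    & forall x, A x -> exists2 d, S d &
        [\/ K (d * x^-1), K (x * d^-1) | d = x]].
  have [/exists_maximal_separated[S SP]|nA] := pselect (right_invariant A).
    by exists S.
  (* Dummy value: [M] is applied to right invariant sets only. *)
  by exists set0.
pose B := covered L M.
have BH n : right_invariant (B n).
  elim: n => [//|n IHn] x h [Bx Hh|[d Md Ld] Hh]; first by left; exact: IHn.
  have [_ MH _ _] := MP _ (right_invariantC IHn).
  by right; exists (d * h); [exact: MH|rewrite invgM mulgA mulgK].
have Bmono i j : (i <= j)%N -> B i `<=` B j.
  elim: j => [|j IHj]; first by rewrite leqn0 => /eqP->.
  by rewrite leq_eqVlt => /predU1P[->//|/IHj ij x /ij]; left.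
(* In all three cases of maximality the quotient [d x^-1] lies in this compact set. *)
pose C' := C `|` [set x^-1 | x in C] `|` [set 1].
have cC' : compact C'.
  apply: compactU; last exact: compact_set1.
  apply: compactU => //; apply: continuous_compact => //.
  by apply: continuous_subspaceT; exact: invg_continuous.
have [n nP] := compact_pigeonhole cC' L1.
exists n, (fun j => M (~` B j)).
have MB j := MP _ (right_invariantC (BH j)).
split=> [j|j|x]; [by have [] := MB j|by have [] := MB j|].
have : B n x.
  apply: contrapT => nBx.
  have /choice[d dP] (j : 'I_n) : exists d, M (~` B j) d /\ C' (d * x^-1).
    have [_ _ _ /(_ x)[|d Md dx]] := MB j.
      by move=> Bx; apply: nBx; apply: Bmono Bx; exact: ltnW.
    exists d; split=> //; case: dx => [/KC Cd|/KC Cd|->].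
    - by left; left.
    - by left; right; exists (x * d^-1) => //; rewrite invgM invgK.
    - by right; rewrite /= mulgV.
  have [j|i [j [ij Lij]]] := nP (fun j => d j * x^-1); first by have [] := dP j.
  (* [d j] lies in [L^-1 d i], hence is covered at stage [i.+1], at most [j]; yet class [j] avoids
     what is covered at stage [j]. *)
  have [subB _ _ _] := MB j; have [Mdj _] := dP j.
  apply: (subB _ Mdj); apply: (Bmono _ _ ij); right; exists (d i).
    by have [] := dP i.
  by move: Lij; rewrite invgM invgK mulgA mulgVK.
elim: {nP} n => [//|n IHn] [/IHn[j [d [jn Md Ld]]]|[d Md Ld]].
  by exists j, d; split=> //; exact: ltnW.
by exists n, d.
Qed.

End Separated.

(** * The system of coloured cosets *)

Section ClosedConditions.
Context {Y : topologicalType}.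
Hypotheses (T2Y : hausdorff_space Y) (lcY : locally_compact [set: Y]).

Lemma closed_hit (C : set Y) : compact C -> closed [set A : fell Y | A `&` C !=set0].
Proof.
move=> cC; rewrite (_ : [set A | _] = ~` [set A : fell Y | A `&` C = set0]).
  exact/open_closedC/miss_open.
by apply/seteqP; split=> A /= => [/set0P/eqP|/eqP/set0P].
Qed.

(** If the conclusion fails at a limit [t], then [w t] misses a compact neighbourhood of [f (a, b)].
    Near [t], [w] still misses it, while [u] and [v] still have points close to [a] and [b], related
    because [R] is open. *)
Lemma closed_implication (T : topologicalType) (u v w : T -> fell Y)
    (R : set (Y * Y)) (f : Y * Y -> Y) :
    continuous u -> continuous v -> continuous w -> open R -> continuous f ->
  closed [set t | forall a b, fell_set (u t) a -> fell_set (v t) b ->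
    R (a, b) -> fell_set (w t) (f (a, b))].
Proof.
move=> cu cv cw oR cf t clt a b ua vb Rab; apply: contrapT => nwab.
have [K [cK abK Kw]] : exists K, [/\ compact K, nbhs (f (a, b)) K & K `<=` ~` w t].
  apply: compact_nbhs => //; apply: open_nbhs_nbhs; split=> //.
  exact/closed_openC/fell_closed.
have [[U V] /= [aU bV] UVR] : nbhs (a, b) (R `&` f @^-1` K).
  by apply: filterI; [exact: open_nbhs_nbhs|exact: cf].
have missw : nbhs (w t) [set A : fell Y | A `&` K = set0].
  by apply: nbhs_miss => //; rewrite -subset0 => y [wy /Kw].
have hitu : nbhs t [set s | u s `&` U !=set0] := cu t _ (nbhs_hit ua aU).
have hitv : nbhs t [set s | v s `&` V !=set0] := cv t _ (nbhs_hit vb bV).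
have {}missw : nbhs t [set s | w s `&` K = set0] := cw t _ missw.
have [s [sP [[[a' [ua' Ua']] [b' [vb' Vb']]] wK]]] :=
  clt _ (filterI (filterI hitu hitv) missw).
have [Rab' Kf] : (R `&` f @^-1` K) (a', b') by exact: UVR.
have : (w s `&` K) (f (a', b')) by split=> //; exact: sP.
by rewrite wK.
Qed.

End ClosedConditions.

(** * Closed subgroups inside the Fell space *)

Section FellOfSubgroup.
Context {G : topologicalGroupType}.

Definition fell_of (K : closed_subgroup G) : fell G := Fell (@subgroup_closed G K).

Lemma fell_of_inj : injective fell_of.
Proof. by move=> A B AB; apply: closed_subgroup_ext; case: AB. Qed.

(** The Chabauty and Fell subbases are given by the same formulas, so convergence can be tested on
    the underlying closed sets. *)
Lemma fell_of_cvg (F : set_system (closed_subgroup G)) K : Filter F ->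
  fell_of @ F --> fell_of K -> F --> K.
Proof.
move=> FF FK; apply: (@subbase_cvg _ (@chabauty_subbase G)) => //.
move=> _ [[C cC <-] KC|[V oV <-] [x [Kx Vx]]].
  exact: (FK _ (nbhs_miss (A := fell_of K) cC KC)).
exact: (FK _ (nbhs_hit (A := fell_of K) Kx (open_nbhs_nbhs (conj oV Vx)))).
Qed.

Hypotheses (T2G : hausdorff_space G) (lcG : locally_compact [set: G]).

(** Containing [1] and stability under [a b^-1] are closed conditions, so a limit of closed
    subgroups is a closed subgroup; it lies in [F] because [F] is closed. *)
Lemma closed_fell_of (F : set (closed_subgroup G)) :
  closed F -> closed [set fell_of K | K in F].
Proof.
move=> cF A clA.
have A1 : fell_set A 1.
  have cA := closed_hit (@compact_set1 G 1).
  have [x [Ax <-//]] : A `&` [set 1] !=set0.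
    apply: cA; apply: closureS clA => _ [K FK <-].
    by exists 1; split=> //; exact: subgroup1.
have AMV a b : fell_set A a -> fell_set A b -> fell_set A (a * b^-1).
  have cA := @closed_implication G T2G lcG (fell G) id id id setT
    (fun p => p.1 * p.2^-1) _ _ _ openT _.
  move=> Aa Ab; apply: (cA _ _ _ _ A _ a b) => //; try by move=> B; exact: cvg_id.
    move=> p; apply: mulg_cvg; first exact: cvg_fst.
    by apply: invg_cvg; exact: cvg_snd.
  apply: closureS clA => _ [K FK <-] x y Kx Ky _.
  by apply: subgroupM => //; exact: subgroupV.
have AV a : fell_set A a -> fell_set A a^-1.
  by move=> Aa; rewrite -(mul1g a^-1); exact: AMV.
have AM a b : fell_set A a -> fell_set A b -> fell_set A (a * b).
  by move=> Aa Ab; rewrite -(invgK b); apply: AMV => //; exact: AV.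
pose K := ClosedSubgroup (@fell_closed _ A) A1 AM AV.
have KA : fell_of K = A by exact: fell_ext.
exists K => //; apply: cF => W KW.
(* The traces on closed subgroups of the neighbourhoods of [A] converge to [K], and each of them
   meets [F]. *)
have FA : filter_from (nbhs A) (fun W => fell_of @^-1` W) --> K.
  apply: fell_of_cvg; last by rewrite KA => U AU; exists U.
  apply: filter_from_filter; first by exists setT; exact: filterT.
  by move=> U V AU AV'; exists (U `&` V) => //; exact: filterI.
have [W' AW' W'W] := FA _ KW.
have [_ [[K' FK' <-] W'K']] := clA _ AW'.
by exists K'; split=> //; exact: W'W.
Qed.

End FellOfSubgroup.

Section Translations.
Context (G : topologicalGroupType).

Lemma conjg_act1 (y : G) : 1 * y * 1^-1 = y.
Proof. by rewrite invg1 mulg1 mul1g. Qed.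

Lemma conjg_actM (g h y : G) : g * h * y * (g * h)^-1 = g * (h * y * h^-1) * g^-1.
Proof. by rewrite invgM !mulgA. Qed.

Lemma conjg_act_continuous : continuous (fun p : G * G => p.1 * p.2 * p.1^-1).
Proof.
move=> p; apply: mulg_cvg; last by apply: invg_cvg; exact: cvg_fst.
by apply: mulg_cvg; [exact: cvg_fst|exact: cvg_snd].
Qed.

Definition conjg_action : continuous_action G G :=
  ContinuousAction (act := fun g y => g * y * g^-1)
    conjg_act1 conjg_actM conjg_act_continuous.

Lemma rtrans_act1 (y : G) : y * 1^-1 = y.
Proof. by rewrite invg1 mulg1. Qed.

Lemma rtrans_actM (g h y : G) : y * (g * h)^-1 = y * h^-1 * g^-1.
Proof. by rewrite invgM !mulgA. Qed.

Lemma rtrans_act_continuous : continuous (fun p : G * G => p.2 * p.1^-1).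
Proof.
move=> p; apply: mulg_cvg; first exact: cvg_snd.
by apply: invg_cvg; exact: cvg_fst.
Qed.

Definition rtrans_action : continuous_action G G :=
  ContinuousAction (act := fun g y => y * g^-1)
    rtrans_act1 rtrans_actM rtrans_act_continuous.

End Translations.

Lemma Stab_act (G : topologicalGroupType) (X : topologicalType)
    (T2X : hausdorff_space X) (a : continuous_action G X) g x :
  Stab T2X a (a g x) = conj_subgroup g (Stab T2X a x).
Proof.
apply: closed_subgroup_ext; rewrite /= conj_setE; apply/seteqP.
split=> h; rewrite /stab_set /= -?actM => hgx.
  by rewrite -mulgA actM hgx -actM mulVg act1.
by rewrite -[in RHS]hgx -!actM !mulgA mulgV mul1g.
Qed.

(** [K g] contains the elements [l g^-1 l^-1] that detect stabilizers. It is open so that separation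
    is a closed condition, and has the compact bound [C g] so that finitely many colours suffice. *)
Lemma exists_open_conjugates (G : topologicalGroupType) :
    hausdorff_space G -> locally_compact [set: G] ->
  exists (L : set G) (K C : G -> set G), [/\ compact L, nbhs 1 L,
    forall g, [/\ open (K g), K g `<=` C g & compact (C g)]
    & forall g l, L l -> K g (l * g^-1 * l^-1)].
Proof.
move=> T2G lcG.
have [C [cC C1 _]] := compact_nbhs T2G lcG (filterT : nbhs (1 : G) setT).
have [L [cL L1 LC]] := compact_nbhs T2G lcG (nbhs_interior C1).
exists L, (fun g => [set p.1 * g^-1 * p.2^-1 | p in C° `*` C°]),
  (fun g => [set p.1 * g^-1 * p.2^-1 | p in C `*` C]).
split=> // [g|g l Ll]; last by exists (l, l) => //; split; exact: LC.
split.
- rewrite openE => _ [[u v] [/= Cu Cv] <-].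
  (* For [x] near [k], write [x = (x k^-1 u) g^-1 v^-1] with [x k^-1 u] near [u]. *)
  pose k := u * g^-1 * v^-1.
  have ku : x * k^-1 * u @[x --> k] --> k * k^-1 * u.
    apply: mulg_cvg; last exact: cvg_cst.
    by apply: mulg_cvg; [exact: cvg_id|exact: cvg_cst].
  have : nbhs k [set x | C° (x * k^-1 * u)].
    apply: ku; rewrite mulgV mul1g; exact: nbhs_interior.
  apply: filterS => x /= Cx; exists (x * k^-1 * u, v) => //=.
  by rewrite -[RHS](mulgVK k) {3}/k !mulgA.
- by move=> _ [p [Cp1 Cp2] <-]; exists p => //; split; exact: interior_subset.
- apply: continuous_compact; last exact: compact_setX.
  apply: continuous_subspaceT => p; apply: mulg_cvg.
    by apply: mulg_cvg; [exact: cvg_fst|exact: cvg_cst].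
  by apply: invg_cvg; exact: cvg_snd.
Qed.

(** The classes produced by Zorn's lemma are replaced by their closures to become points of the Fell
    space. *)
Lemma closure_right_invariant (G : topologicalGroupType)
    (H : closed_subgroup G) (S : set G) :
  right_invariant H S -> right_invariant H (closure S).
Proof.
move=> SH d h clSd Hh V Vdh.
have dh : x * h @[x --> d] --> d * h.
  by apply: mulg_cvg; [exact: cvg_id|exact: cvg_cst].
have [x [Sx Vx]] := clSd _ (dh _ Vdh).
by exists (x * h); split=> //; exact: SH.
Qed.

(** As [K] is open, related points of the closure are limits of related points of [S]; as [H] is
    closed, the conclusion passes to the limit. *)
Lemma closure_coset_separated (G : topologicalGroupType)
    (H : closed_subgroup G) (K S : set G) :
  open K -> coset_separated H K S -> coset_separated H K (closure S).
Proof.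
move=> oK SK d d' clSd clSd' Kdd'; apply: (@subgroup_closed _ H) => V Vdd'.
have cK : p.2 * p.1^-1 @[p --> (d, d')] --> d' * d^-1.
  by apply: mulg_cvg; [exact: cvg_snd|apply: invg_cvg; exact: cvg_fst].
have cV : p.1^-1 * p.2 @[p --> (d, d')] --> d^-1 * d'.
  by apply: mulg_cvg; [apply: invg_cvg; exact: cvg_fst|exact: cvg_snd].
have [[U U'] /= [Ud Ud'] UUP] : nbhs (d, d')
    [set p | K (p.2 * p.1^-1) /\ V (p.1^-1 * p.2)].
  by apply: filterI; [apply: cK; exact: open_nbhs_nbhs|exact: cV].
have [[x [Sx Ux]] [x' [Sx' Ux']]] := (clSd _ Ud, clSd' _ Ud').
have [/= Kxx' Vxx'] := UUP (x, x') (conj Ux Ux').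
by exists (x^-1 * x'); split=> //; exact: SK.
Qed.

Section ColouredCosets.
Context (G : topologicalGroupType).
Hypotheses (T2G : hausdorff_space G) (lcG : locally_compact [set: G]).

(* Coordinate [None] holds the subgroup and [Some (g, j)] the [j]-th colour
   class for [g], a union of left cosets of the subgroup; an element of [G]
   conjugates the former and translates the latter on the right. *)
Definition coset_index := option (G * nat).

Definition coset_families := prod_topology (fun _ : coset_index => fell G).

Definition coset_families_action : continuous_action G coset_families :=
  prod_action (fun i : coset_index =>
    fell_action T2G lcG (if i is Some _ then rtrans_action G else conjg_action G)).

Lemma coset_families_hausdorff : hausdorff_space coset_families.
Proof. by apply: hausdorff_product => i; exact: fell_hausdorff. Qed.

Lemma coset_families_compact : compact [set: coset_families].
Proof.
have := tychonoff (fun _ : coset_index => @fell_compact G).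
by rewrite (_ : [set f | _] = setT)//; apply/seteqP; split.
Qed.

Variables (F : set (closed_subgroup G)) (L : set G) (K : G -> set G) (n : G -> nat).

(** The properties of [H] and its classes, with [H] replaced by the varying coordinate [None]. The
    bound [n g] is fixed, so that the cover of each [x] is a finite union of closed conditions. *)
Definition coloured (e : coset_families) := [/\
  [set fell_of A | A in F] (e None),
  forall i d h, fell_set (e (Some i)) d -> fell_set (e None) h ->
    fell_set (e (Some i)) (d * h),
  forall i d d', fell_set (e (Some i)) d -> fell_set (e (Some i)) d' ->
    K i.1 (d' * d^-1) -> fell_set (e None) (d^-1 * d')
  & forall g x, exists j d,
      [/\ (j < n g)%N, fell_set (e (Some (g, j))) d & L (d * x^-1)]].

Hypotheses (cF : closed F) (oK : forall g, open (K g)) (cL : compact L).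
Hypotheses (Fconj : forall g A, F A -> F (conj_subgroup g A))
  (LK : forall g l, L l -> K g (l * g^-1 * l^-1)).

(** The separation is an implication with an open premise, as [K] is open; the cover says that one
    of finitely many classes meets the compact set [L x]. *)
Lemma coloured_closed : closed coloured.
Proof.
have pc i : continuous (fun e : coset_families => e i) by exact: proj_continuous.
rewrite (_ : coloured = [set e | [set fell_of A | A in F] (e None)] `&`
  \bigcap_i [set e | forall d h, fell_set (e (Some i)) d ->
    fell_set (e None) h -> setT (d, h) ->
    fell_set (e (Some i)) ((d, h).1 * (d, h).2)] `&`
  \bigcap_i [set e | forall d d', fell_set (e (Some i)) d ->
    fell_set (e (Some i)) d' -> [set p | K i.1 (p.2 * p.1^-1)] (d, d') ->
    fell_set (e None) ((d, d').1^-1 * (d, d').2)] `&`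
  \bigcap_gx \bigcup_(j in `I_(n gx.1)) [set e | fell_set (e (Some (gx.1, j))) `&`
     [set l * gx.2 | l in L] !=set0]).
  apply: closedI; [apply: closedI; [apply: closedI|]|].
  - apply: preimage_closed => [e _|]; first exact: pc.
    exact: closed_fell_of.
  - apply: closed_bigI => i _.
    apply: (@closed_implication _ T2G lcG _ _ _ _ setT (fun p => p.1 * p.2)) => //.
      exact: openT.
    exact: mulg_continuous.
  - apply: closed_bigI => i _.
    apply: (@closed_implication _ T2G lcG _ _ _ _ [set p | K i.1 (p.2 * p.1^-1)]
      (fun p => p.1^-1 * p.2)) => //.
      apply: (@open_comp _ _ (fun p : G * G => p.2 * p.1^-1) (K i.1)) => // p _.
      apply: mulg_cvg; first exact: cvg_snd.
      by apply: invg_cvg; exact: cvg_fst.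
    move=> p; apply: mulg_cvg; last exact: cvg_snd.
    by apply: invg_cvg; exact: cvg_fst.
  - apply: closed_bigI => -[g x] _; apply: closed_bigcup; first exact: finite_II.
    move=> j _; apply: (@preimage_closed coset_families (fell G)
        (fun e => e (Some (g, j)))
        [set A : fell G | A `&` [set l * x | l in L] !=set0]) => [e _|].
      exact: pc.
    apply: closed_hit; apply: continuous_compact => //.
    apply: continuous_subspaceT => l.
    by apply: mulg_cvg; [exact: cvg_id|exact: cvg_cst].
apply/seteqP; split=> e.
  move=> [e1 e2 e3 e4]; do !split=> //.
  - by move=> i _ d h ed eh _; exact: e2.
  - by move=> i _ d d'; exact: e3.
  - move=> [g x] _ /=; have [j [d [jn ed Ld]]] := e4 g x.
    exists j => //; exists d; split=> //; exists (d * x^-1) => //.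
    exact: mulgVK.
move=> [[[e1 e2] e3] e4]; split=> //.
- by move=> i d h ed eh; exact: (e2 i).
- by move=> i d d'; exact: (e3 i).
- move=> g x; have [j /= jn [d [ed [l Ll ld]]]] := e4 (g, x) I.
  by exists j, d; split=> //; rewrite -ld mulgK.
Qed.

(** Translation by [g^-1] turns [d H] into [(d g^-1) (g H g^-1)] and leaves [d' d^-1] unchanged; the
    cover at [x] comes from the one at [x g]. *)
Lemma coloured_invariant : act_invariant coset_families_action coloured.
Proof.
move=> g e [[A FA Ae] e2 e3 e4]; split=> /=.
- exists (conj_subgroup g A); first exact: Fconj.
  apply: fell_ext; rewrite /= conj_setE /prod_act /= -Ae; apply/seteqP.
  by split=> x /=; rewrite invgK.
- move=> i d h /=; rewrite !invgK => ed eh.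
  by have := e2 i _ _ ed eh; rewrite !mulgA mulgK.
- move=> i d d' /=; rewrite !invgK => ed ed' Kdd'.
  by have := e3 i _ _ ed ed'; rewrite invgM !mulgA mulgK; apply.
- move=> g' x; have [j [d [jn ed Ld]]] := e4 g' (x * g).
  exists j, (d * g^-1); split=> //=; first by rewrite invgK mulgVK.
  by rewrite -mulgA -invgM.
Qed.

(* If [g] fixes [e], then [d] and [d g^-1] belong to the same family; they are
   [K g]-close for [d] in [L], hence equal modulo the subgroup. *)
Lemma coloured_stab e g : coloured e ->
  coset_families_action g e = e <-> fell_set (e None) g.
Proof.
move=> [[A FA Ae] e2 e3 e4]; split=> [ge|eg].
  have [j [d [_ ed]]] := e4 g 1; rewrite invg1 mulg1 => Ld.
  have edg : fell_set (e (Some (g, j))) (d * g^-1).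
    by rewrite -ge /= /prod_act /= invgK mulgVK.
  have := e3 _ _ _ ed edg (LK g Ld).
  by rewrite mulKg -Ae => /subgroupV; rewrite invgK.
have eVg : fell_set (e None) g^-1 by move: eg; rewrite -Ae => /subgroupV.
apply: functional_extensionality_dep => -[i|]; apply/fell_ext/seteqP; split=> x /=.
- by rewrite invgK => exg; rewrite -(mulgK g x); exact: e2.
- by rewrite invgK => ex; exact: e2.
- move: eg eVg; rewrite -Ae /= invgK => Ag AVg Axg.
  have := subgroupM (subgroupM Ag Axg) AVg.
  by rewrite !mulgA mulgV mul1g mulgK.
- move: eg eVg; rewrite -Ae /= invgK => Ag AVg Ax.
  exact: subgroupM (subgroupM AVg Ax) Ag.
Qed.

End ColouredCosets.

(** * A minimal system of coloured cosets and its stabilizers *)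

Theorem corollary1p2 (G : topologicalGroupType)
    (T2G : hausdorff_space G) (lcG : locally_compact [set: G])
    (F : set (closed_subgroup G)) (F_URS : is_URS F) :
  exists (X : topologicalType) (T2X : hausdorff_space X)
         (a : continuous_action G X),
    [/\ compact [set: X], minimal_action a, is_stabilizer_URS T2X a F
      & continuous (Stab T2X a)].
Proof.
have [[H FH] cF Fconj Fmin] := F_URS.
have [L [K [C [cL L1 KC LK]]]] := exists_open_conjugates T2G lcG.
have /choice[n nP] g : exists m, exists D : nat -> set G,
    [/\ forall j, right_invariant H (D j), forall j, coset_separated H (K g) (D j)
      & forall x, exists j d, [/\ (j < m)%N, D j d & L (d * x^-1)]].
  have [_ KCg cCg] := KC g.
  have [m [D DP]] := exists_separated_cover H KCg cCg L1.
  by exists m, D.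
have /choice[D DP] := nP.
have oK g : open (K g) by have [] := KC g.
pose b := coset_families_action T2G lcG.
pose Z := coloured F L K n.
(* A point of the system: [H] with the closures of its colour classes. *)
pose e0 : coset_families G := fun i =>
  if i is Some (g, j) then Fell (@closed_closure _ (D g j)) else fell_of H.
have Ze0 : Z e0.
  split=> [|[g j]|[g j]|g x]; first by exists H.
  - by apply: closure_right_invariant; have [] := DP g.
  - by apply: closure_coset_separated => //; have [] := DP g.
  - have [_ _ /(_ x)[j [d [jn Dd Ld]]]] := DP g.
    by exists j, d; split=> //; exact: subset_closure.
have Zb : act_invariant b Z := @coloured_invariant G T2G lcG F L K n Fconj.
have [M [MZ cM Mb [x0 Mx0] Mmin]] := exists_minimal_set
  (@coset_families_compact G) (@coloured_closed G T2G lcG F L K n cF oK cL) Zb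
  (ex_intro _ e0 Ze0).
have T2X : hausdorff_space M.
  by apply: set_type_hausdorff; exact: coset_families_hausdorff.
pose a := sub_action Mb.
have stabP (x : M) g : b g (set_val x) = set_val x <-> fell_set (set_val x None) g.
  exact: (@coloured_stab G T2G lcG F L K n LK _ g (MZ _ (set_valP x))).
have StabE (x : M) : fell_of (Stab T2X a x) = set_val x None.
  apply: fell_ext; apply/seteqP; split=> g /=.
    by move=> gx; apply/stabP; exact: (congr1 set_val gx).
  by move=> xg; apply: val_inj; apply/stabP.
have StabF x : F (Stab T2X a x).
  have [[A FA Ax] _ _ _] := MZ _ (set_valP x).
  suff -> : Stab T2X a x = A by [].
  by apply: fell_of_inj; rewrite StabE.
have denseX (x y : M) : closure (action_orbit b (set_val x)) (set_val y).
  exact: Mmin (set_valP x) _ (set_valP y).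
exists M, T2X, a; split.
- apply: set_type_compact.
  by apply: (subclosed_compact cM (@coset_families_compact G)).
- split; first by exists (SigSub (mem_set Mx0)).
  move=> x O [y Oy] [O' oO' O'O].
  have O'y : O' (set_val y) by move: Oy; rewrite -O'O.
  have [_ [[g _ <-] O'gx]] := denseX x y O' (open_nbhs_nbhs (conj oO' O'y)).
  by exists (a g x); split; [rewrite -O'O|exists g].
- have clF : closure (range (Stab T2X a)) `<=` F.
    by move=> A clA; apply: cF; apply: closureS clA => _ [x _ <-]; exact: StabF.
  split.
    (* By equivariance the stabilizers contain a conjugation orbit in [F], and its closure contains
       [F]. *)
    split=> //; apply: subset_trans (Fmin _ (StabF (SigSub (mem_set Mx0)))) _.
    by apply: closureS => _ [g _ <-]; rewrite -Stab_act; eexists.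
  (* Another URS in the closure lies in [F]; being closed and invariant, it contains an orbit
     closure, hence all of [F]. *)
  move=> F' [[[A F'A] cF' F'conj _] F'X].
  have F'F : F' `<=` F := subset_trans F'X clF.
  apply/seteqP; split=> //; apply: subset_trans (Fmin _ (F'F _ F'A)) _.
  apply: subset_trans cF'; apply: closureS => _ [g _ <-]; exact: F'conj.
(* Followed by [fell_of], the stabilizer map is the coordinate [None], which is continuous. *)
- move=> x.
  have FF : Filter (Stab T2X a y @[y --> x]).
    exact: (fmap_filter (Stab T2X a) (nbhs_filter x)).
  apply: fell_of_cvg; rewrite StabE -[fell_of @ _]/((fell_of \o Stab T2X a) @ x).
  have -> : fell_of \o Stab T2X a = (fun e : coset_families G => e None) \o set_val.
    by apply: funext => y; rewrite /= StabE.
  apply: (@cvg_comp _ _ _ set_val _ _ (nbhs (set_val x : coset_families G))).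
    exact: (@initial_continuous M (coset_families G) set_val).
  exact: (@proj_continuous (coset_index G) (fun=> fell G)).
Qed.
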